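(* Let $p$ be a prime and let $M$ be a (nondegenerate) finite quadratic module whose order is a power of $p$. Suppose $\dim_{\mathbb{F}_p} (M\otimes \mathbb{F}_p)\le 2$. Then $\mathrm{Inv}(M)\neq 0$ if and only if $|M|$ is a perfect square and $\sigma(M)=1$.
   Context: A finite quadratic module is a finite abelian group $M$ with a map $Q_M:M\to\mathbb{Q}/\mathbb{Z}$ such that $Q_M(ax)=a^2Q_M(x)$ for all $x\in M$, $a\in\mathbb{Z}$, and such that $B_M(x,y):=Q_M(x+y)-Q_M(x)-Q_M(y)$ is $\mathbb{Z}$-bilinear; it is nondegenerate if $B_M(x,y)=0$ for all $y$ implies $x=0$. Write $e(t)=\exp(2\pi i t)$. The metaplectic group $\mathrm{Mp}=\mathrm{Mp}_2(\mathbb{Z})$ is the group of pairs $(A,w)$ with $A=[a,b;c,d]\in \mathrm{SL}_2(\mathbb{Z})$ and $w$ a holomorphic function on the upper half plane $\mathbb{H}$ with $w(\tau)^2=c\tau+d$, with product $(A,w)(B,v)=(AB,w(B\tau)v(\tau))$. Let $T=[1,1;0,1]$, $S=[0,-1;1,0]$, and $w_S(\tau)=\sqrt{\tau}$ (branch with positive real part). Put $\sigma(M)=|M|^{-1/2}\sum_{x\in M}e(-Q_M(x))$. The Weil representation $W(M)$ is the complex vector space with basis $\{\mathfrak{e}_x: x\in M\}$ equipped with the unique left action of $\mathrm{Mp}$ such that $(T,1)\mathfrak{e}_x=e(Q_M(x))\mathfrak{e}_x$ and $(S,w_S)\mathfrak{e}_x=\sigma(M)|M|^{-1/2}\sum_{y\in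 M}e(-B_M(y,x))\mathfrak{e}_y$. $\mathrm{Inv}(M)$ denotes the subspace of $\mathrm{Mp}$-invariant vectors in $W(M)$. *)

(* Defs.v *)
From HB Require Import structures.
From mathcomp Require Import all_boot all_order all_algebra.
From mathcomp Require Import all_classical all_reals.
From mathcomp Require Import trigo.
From mathcomp Require Import complex.

Set Implicit Arguments.
Unset Strict Implicit.
Unset Printing Implicit Defensive.

Import Order.TTheory GRing.Theory Num.Theory.
Local Open Scope ring_scope.
Local Open Scope complex_scope.

(* r is an integer: used to work in Q/Z via representatives in Q *)
Definition is_intq (r : rat) : Prop := r \is a Num.int.

Definition e_ (R : realType) (t : rat) : R[i] :=
  (cos (2 * pi * ratr t)) +i* (sin (2 * pi * ratr t)).

(* A quadratic form M -> Q/Z, represented by a rational-valued map Q;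
   all conditions are imposed modulo Z. *)
Definition bil (M : finZmodType) (Q : M -> rat) (x y : M) : rat :=
  Q (x + y) - Q x - Q y.

Definition is_fqm (M : finZmodType) (Q : M -> rat) : Prop :=
  (forall (x : M) (a : int), is_intq (Q (x *~ a) - (a%:~R) ^+ 2 * Q x)) /\
  (forall x1 x2 y : M, is_intq (bil Q (x1 + x2) y - bil Q x1 y - bil Q x2 y)) /\
  (forall x y1 y2 : M, is_intq (bil Q x (y1 + y2) - bil Q x y1 - bil Q x y2)).

Definition fqm_nondegenerate (M : finZmodType) (Q : M -> rat) : Prop :=
  forall x : M, (forall y : M, is_intq (bil Q x y)) -> x = 0.

Definition sigma_fqm (R : realType) (M : finZmodType) (Q : M -> rat) : R[i] :=
  ((Num.sqrt (#|M|%:R : R))^-1)%:C * \sum_(x : M) e_ R (- Q x).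

(* The Weil representation W(M): vectors are functions M -> C,
   v = sum_x v(x) e_x. *)
Definition Wvec (R : realType) (M : finZmodType) := {ffun M -> R[i]}.

Definition weilT (R : realType) (M : finZmodType) (Q : M -> rat) (v : Wvec R M)
  : Wvec R M := [ffun x => e_ R (Q x) * v x].

Definition weilS (R : realType) (M : finZmodType) (Q : M -> rat) (v : Wvec R M)
  : Wvec R M :=
  [ffun y => sigma_fqm R Q * ((Num.sqrt (#|M|%:R : R))^-1)%:C *
             \sum_(x : M) e_ R (- bil Q y x) * v x].

(* Inv(M): vectors fixed by Mp, i.e. by its generators (T,1) and (S,w_S). *)
Definition is_invariant (R : realType) (M : finZmodType) (Q : M -> rat)
  (v : Wvec R M) : Prop := weilT Q v = v /\ weilS Q v = v.

Definition Inv_nonzero (R : realType) (M : finZmodType) (Q : M -> rat) : Prop :=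
  exists v : Wvec R M, v != 0 /\ is_invariant Q v.

Definition pmult_set (M : finZmodType) (p : nat) : {set M} :=
  [set x *+ p | x : M].

(* dim_{F_p} (M / pM) = log_p |M / pM| *)
Definition dim_mod_p (M : finZmodType) (p : nat) : nat :=
  logn p (#|M| %/ #|pmult_set M p|).

(* Main.v *)
Require Import Defs.
From HB Require Import structures.
From mathcomp Require Import all_boot all_order all_algebra.
From mathcomp Require Import all_field.
From mathcomp Require Import all_classical all_reals.
From mathcomp Require Import trigo.
From mathcomp Require Import complex.
Import Order.TTheory GRing.Theory Num.Theory.
Local Open Scope ring_scope.

Set Implicit Arguments.
Unset Strict Implicit.
Unset Printing Implicit Defensive.

(** Both conditions are equivalent to the existence of a self-dual isotropic
    subgroup [L], i.e. [Q = 0] on [L] and [L = L^perp]: its indicator function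
    is then invariant, and [sigma M = #|L| / sqrt #|M| = 1].

    If [#|M| = n ^ 2] and [sigma M = 1], take [H] maximal isotropic, so that
    the isotropic vectors of [H^perp] are those of [H].  Then
    [sum_(x in H^perp) e(- Q x) = n]; as [n] is rational, one may average this
    identity over the Galois conjugates, which gives
    [n (p - 1) + #{x in H^perp | p Q(x) = 0} = p #|H|].  Hence [n <= #|H|] and
    [H] is self-dual.

    If [v <> 0] is invariant, its support consists of isotropic vectors.  Take
    [H] maximal among the isotropic subgroups with [supp v] in [H^perp].  If
    [supp v] lies in [H], then [v = S v] is invariant under translation by
    [H^perp], so [H^perp = H].  Otherwise choose [z] in [supp v] of maximal
    order [p ^ c.+1] modulo [H].  By maximality of [H] some [y] in [supp v] is
    not orthogonal to [z *+ p ^ c], so [y] and [z] span a hyperbolic plane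
    in [H^perp / H]; since this group has [p]-rank at most 2, it is that plane,
    and [H + <z>] is self-dual. *)

(** * Galois conjugation of roots of unity and of their sums *)

(** As [z ^+ n - 1] is the product of the ['Phi_d] over [d] dividing [n], some ['Phi_d] vanishes at
    [z]; then [z ^+ d = 1], which forces [d = n]. *)
Lemma root_Cyclotomic (F : numFieldType) (n : nat) (z : F) :
  n.-primitive_root z -> root (map_poly intr ('Phi_n : {poly int})) z.
Proof.
move=> prim_z; have n_gt0 := prim_order_gt0 prim_z.
have Phi_prod (d : nat) : (d > 0)%N ->
    \prod_(e <- divisors d) (map_poly intr ('Phi_e : {poly int})).[z] = z ^+ d - 1.
  move=> d_gt0; rewrite -horner_prod -rmorph_prod /= prod_Cyclotomic //.
  by rewrite rmorphB /= map_polyXn rmorph1 !hornerE.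
have /eqP := Phi_prod n n_gt0.
rewrite (prim_expr_order prim_z) subrr prodf_seq_eq0 => /hasP[d].
rewrite -dvdn_divisors //= => d_dvd /eqP root_d.
have d_gt0 := dvdn_gt0 n_gt0 d_dvd.
have /eqP := Phi_prod d d_gt0.
rewrite (big_rem d) -?dvdn_divisors //= root_d mul0r eq_sym subr_eq0.
rewrite -(prim_order_dvd prim_z) => n_dvd.
by have -> : n = d; [apply/eqP; rewrite eqn_dvd n_dvd d_dvd | apply/rootP].
Qed.

(* The rational polynomials vanishing at a primitive root are the multiples of
   the cyclotomic polynomial, whose irreducibility is known over [algC]. *)
Lemma root_primitive_conj (F : numFieldType) (n : nat) (P : {poly rat}) (z w : F) :
  n.-primitive_root z -> n.-primitive_root w ->
  root (map_poly ratr P) z -> root (map_poly ratr P) w.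
Proof.
move=> prim_z prim_w Pz; have n_gt0 := prim_order_gt0 prim_z.
set Phi := map_poly intr ('Phi_n : {poly int}) : {poly rat}.
have mapPhi (K : numFieldType) : map_poly (ratr : rat -> K) Phi = map_poly intr 'Phi_n.
  by rewrite -map_poly_comp; apply: eq_map_poly => a /=; rewrite ratr_int.
have irrPhi (x : algC) : n.-primitive_root x ->
    forall S, root (map_poly ratr S) x = (Phi %| S)%R.
  move=> prim_x; have [p0 [Ep0 _] dvd_p0] := minCpolyP x.
  suff -> : Phi = p0 by [].
  apply: (map_poly_inj (ratr : rat -> algC)).
  by rewrite mapPhi -Ep0 (minCpoly_cyclotomic prim_x) (Cintr_Cyclotomic prim_x).
(* Coprimality over [rat] does not depend on the extension field, so the common root [z] in [F]
   yields a common root in [algC]. *)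
have ncop : ~~ coprimep P Phi.
  apply: contraL Pz; rewrite -(coprimep_map (ratr : rat -> F)) coprimep_sym => cop.
  by rewrite rootE (coprimep_root cop) // mapPhi root_Cyclotomic.
have [x [Px Phix]] : exists x : algC, root (map_poly ratr P) x /\ root (map_poly ratr Phi) x.
  move: ncop; rewrite -(coprimep_map (ratr : rat -> algC)) /coprimep.
  move/closed_rootP=> [x]; rewrite root_gcd => /andP[Px Phix].
  by exists x.
have [y prim_y] := C_prim_root_exists n_gt0.
have prim_x : n.-primitive_root x.
  by move: Phix; rewrite mapPhi (Cintr_Cyclotomic prim_y) root_cyclotomic.
move: Px; rewrite irrPhi // => /dvdpP[U ->].
by rewrite rmorphM rootM /= mapPhi root_Cyclotomic // orbT.
Qed.

(** Being rational, the sum keeps its value when every [u i] is raised to a power [k] prime to [p];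
    adding these equalities over all such [k] modulo [p ^ r.+1] gives the identity. *)
Lemma root_sum_nat (F : numFieldType) (p r n : nat) (z : F) (I : finType)
    (A : {pred I}) (u : I -> F) :
  prime p -> (p ^ r.+1).-primitive_root z ->
  (forall i, u i ^+ (p ^ r.+1) = 1) -> \sum_(i in A) u i = n%:R ->
  (n * p.-1 + #|[pred i in A | u i ^+ p == 1%R]| = p * #|[pred i in A | u i == 1%R]|)%N.
Proof.
move=> p_pr prim_z u1 sum_u; set m := (p ^ r)%N.
have p_gt0 := prime_gt0 p_pr.
have m_gt0 : (0 < m)%N by rewrite expn_gt0 p_gt0.
have conj k : coprime k p -> \sum_(i in A) u i ^+ k = n%:R.
  move=> co_kp; pose j i : nat := sval (prim_rootP prim_z (u1 i)).
  have uE i : u i = z ^+ j i by rewrite /j; case: prim_rootP.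
  pose P : {poly rat} := \sum_(i in A) 'X^(j i) - n%:R%:P.
  have PE x : (map_poly ratr P).[x] = \sum_(i in A) x ^+ j i - n%:R :> F.
    rewrite rmorphB rmorph_sum /= map_polyC /= ratr_nat hornerD hornerN hornerC.
    rewrite horner_sum; congr (_ - _); apply: eq_bigr => i _.
    by rewrite map_polyXn hornerXn.
  have := @root_primitive_conj F _ P z (z ^+ k) prim_z.
  rewrite prim_root_exp_coprime // coprimeXr // => /(_ isT).
  rewrite !rootE !PE; under eq_bigr do rewrite -uE.
  rewrite sum_u subrr eqxx => /(_ isT); rewrite subr_eq0 => /eqP <-.
  by apply: eq_bigr => i _; rewrite uE exprAC.
have geom (y : F) (k : nat) : y ^+ k = 1 -> \sum_(i < k) y ^+ i = if y == 1 then k%:R else 0.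
  move=> yk; case: eqP => [->|/eqP y_neq1].
    by under eq_bigr do rewrite expr1n; rewrite sumr_const card_ord.
  by have /esym/eqP := subrX1 y k; rewrite yk subrr mulf_eq0 subr_eq0 (negPf y_neq1) => /eqP.
have geom' (y : F) : y ^+ p = 1 ->
    \sum_(i < p | i != 0 :> nat) y ^+ i = (if y == 1 then p%:R else 0) - 1.
  move=> yp; rewrite -geom // [in RHS](bigD1 (Ordinal p_gt0)) //= expr0 addrC addrK.
  by apply: eq_bigl => i; rewrite -val_eqE.
(* The exponents p a + s represent the units modulo p ^ r.+1, i.e. the Galois
   group; summed over them, y gives (p - 1) m, - m or 0 according to whether
   y = 1, y has order p, or neither. *)
have sum_all : \sum_(a < m) \sum_(s < p | s != 0 :> nat) \sum_(i in A) u i ^+ (p * a + s)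
    = (m * (p.-1 * n))%:R.
  have -> : (m * (p.-1 * n))%:R = \sum_(a < m) \sum_(s < p | s != 0 :> nat) n%:R :> F.
    rewrite sumr_const card_ord [in RHS](eq_bigl (predC1 (Ordinal p_gt0))); last first.
      by move=> s; rewrite /= -val_eqE.
    by rewrite sumr_const cardC1 card_ord -!mulrnA [(m * _)%N]mulnC [(p.-1 * n)%N]mulnC mulnA.
  apply: eq_bigr => a _; apply: eq_bigr => s s_neq0; apply: conj.
  by rewrite coprime_sym prime_coprime // dvdn_addr ?dvdn_mulr // gtnNdvd ?lt0n.
have sum_i i : \sum_(a < m) \sum_(s < p | s != 0 :> nat) u i ^+ (p * a + s)
    = m%:R * (p%:R * (u i == 1)%:R - (u i ^+ p == 1)%:R).
  under eq_bigr do (under eq_bigr do rewrite exprD exprM; rewrite -mulr_sumr).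
  rewrite -mulr_suml geom; last by rewrite -exprM -expnS u1.
  have [up1|up_neq1] := eqVneq (u i ^+ p) 1.
    by rewrite geom' //; case: eqP; rewrite ?mulr1 ?mulr0.
  rewrite mul0r; case: eqP => [u_eq1|_]; last by rewrite mulr0 subrr mulr0.
  by rewrite u_eq1 expr1n eqxx in up_neq1.
have cardE (B : pred I) : #|[pred i in A | B i]|%:R = \sum_(i in A) (B i)%:R :> F.
  rewrite -sum1_card natr_sum [RHS]big_mkcond [LHS]big_mkcond.
  by apply: eq_bigr => i _; rewrite !inE; case: (i \in A); case: (B i).
have {sum_all} : m%:R * (p.-1 * n)%:R =
    m%:R * (p%:R * #|[pred i in A | u i == 1]|%:R - #|[pred i in A | u i ^+ p == 1]|%:R) :> F.
  rewrite -natrM -sum_all !cardE mulr_sumr -sumrB mulr_sumr.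
  under eq_bigr do rewrite exchange_big.
  rewrite exchange_big /=.
  exact: eq_bigr.
have m_neq0 : m%:R != 0 :> F by rewrite pnatr_eq0 -lt0n.
move/(mulfI m_neq0)/eqP; rewrite eq_sym subr_eq -natrM -natrD eqr_nat => /eqP ->.
by rewrite mulnC.
Qed.

(** * The exponential [e_] and its roots of unity *)

Section Exponential.

Variable R : realType.
Implicit Types s t : rat.

Lemma e_D s t : e_ R (s + t) = e_ R s * e_ R t.
Proof.
by rewrite /e_ rmorphD mulrDr cosD sinD [sin _ * cos _ + _]addrC.
Qed.

Lemma e_0 : e_ R 0 = 1.
Proof. by rewrite /e_ rmorph0 mulr0 cos0 sin0. Qed.

Lemma e_neq0 t : e_ R t != 0.
Proof.
apply/eqP => et0; have /eqP := e_D t (- t).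
by rewrite subrr e_0 et0 mul0r oner_eq0.
Qed.

Lemma e_N t : e_ R (- t) = (e_ R t)^-1.
Proof.
by apply: (mulfI (e_neq0 t)); rewrite -e_D subrr e_0 divff ?e_neq0.
Qed.

Lemma e_natM (n : nat) t : e_ R (n%:R * t) = e_ R t ^+ n.
Proof.
elim: n => [|n IHn]; first by rewrite mul0r e_0.
by rewrite -natr1 mulrDl mul1r e_D IHn exprSr.
Qed.

Lemma e_intM (a : int) t : e_ R (a%:~R * t) = e_ R t ^ a.
Proof.
case: a => n; first exact: e_natM.
by rewrite NegzE mulrNz mulNr e_N e_natM.
Qed.

Lemma e_eq1 t : (e_ R t == 1) = (t \is a Num.int).
Proof.
have e1 : e_ R 1 = 1 by rewrite /e_ rmorph1 mulr1 mulr_natl cos2pi sin2pi.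
have e_int (a : int) : e_ R a%:~R = 1 by rewrite -[a%:~R]mulr1 e_intM e1 exp1rz.
apply/eqP/idP => [et|/intrP[a ->]]; last exact: e_int.
pose f := t - (Num.floor t)%:~R.
have ef : e_ R f = 1 by rewrite e_D et mul1r -rmorphN e_int.
have f_ge0 : 0 <= f by rewrite subr_ge0 floor_le.
have f_lt1 : f < 1 by rewrite ltrBlDl -intrD1 floorD1_gt.
have [f0|f_neq0] := eqVneq f 0.
  by rewrite -[t](subrK (Num.floor t)%:~R) -/f f0 add0r intr_int.
have f_gt0 : 0 < f by rewrite lt_neqAle eq_sym f_neq0.
(* Half the angle lies strictly between 0 and [pi], where the sine is positive, while
   [cos (x + x) = 1] forces [sin x = 0]. *)
pose x : R := pi * ratr f.
have sin_gt0 : 0 < sin x.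
  apply: sin_gt0_pi; rewrite mulr_gt0 ?pi_gt0 ?ltr0q //=.
  by rewrite -[X in _ < X]mulr1 ltr_pM2l ?pi_gt0 // -(rmorph1 (@ratr R)) ltr_rat.
have : cos (x + x) = 1.
  by move: ef => /eqP; rewrite /e_ eq_complex /= mulr_natl mulrnAl mulr2n => /andP[/eqP].
rewrite cosD -!expr2 -(cos2Dsin2 x) => /eqP; rewrite -subr_eq0 opprD addrACA subrr add0r.
rewrite -opprD oppr_eq0 -mulr2n mulrn_eq0 /= sqrf_eq0 => /eqP sin0.
by rewrite sin0 ltxx in sin_gt0.
Qed.

Lemma e_primitive_root (n : nat) : (n > 0)%N -> n.-primitive_root (e_ R n%:R^-1).
Proof.
move=> n_gt0; have n_neq0 : n%:R != 0 :> rat by rewrite pnatr_eq0 -lt0n.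
have en : e_ R n%:R^-1 ^+ n = 1 by rewrite -e_natM mulfV // (eqP (_ : e_ R 1 == 1)) ?e_eq1.
have [m prim_m m_dvd] := prim_order_exists n_gt0 en.
suff mn : m = n by rewrite mn in prim_m.
apply/eqP; rewrite eqn_dvd m_dvd /=.
have /eqP := prim_expr_order prim_m; rewrite -e_natM e_eq1 => /intrP[a aE].
have : m%:R = (a * n)%:~R :> rat by rewrite intrM -aE -mulrA mulVf ?mulr1.
rewrite -[m%:R]/(m%:~R) => /intr_inj mE.
by have : (n%:Z %| m%:Z)%Z by rewrite mE dvdz_mull.
Qed.

End Exponential.

(** * Counting by means of torsion *)

Section Torsion.

Variables (M : finZmodType) (n : nat).

Lemma card_mulrn_fiber (x : M) :
  #|[set y | y *+ n == x *+ n]| = #|[set y : M | y *+ n == 0]|.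
Proof.
rewrite -(card_imset [set y : M | y *+ n == 0] (addrI x)).
apply: eq_card => y; rewrite inE; apply/idP/imsetP => [/eqP yx|[t]].
  by exists (y - x); rewrite ?inE ?mulrnBl ?yx ?subrr ?eqxx // addrC subrK.
by rewrite inE => /eqP t0 ->; rewrite mulrnDl t0 addr0.
Qed.

Lemma card_mulrn :
  #|M| = (#|[set x *+ n | x : M]| * #|[set x : M | (x *+ n == 0)%R]|)%N.
Proof.
rewrite -[LHS]sum1_card (partition_big_imset (fun x => x *+ n)) /=.
rewrite -[RHS]sum_nat_const; apply: eq_big => [y|_ /imsetP[x _ ->]] //.
by rewrite sum1dep_card -(card_mulrn_fiber x).
Qed.

(** Each fibre of multiplication by [n] on [D] lies in a coset of the [n]-torsion. *)
Lemma card_mulrn_leq (D : {set M}) :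
  (#|D| <= #|[set (x *+ n)%R | x in D]| * #|[set x : M | (x *+ n == 0)%R]|)%N.
Proof.
rewrite -[X in (X <= _)%N]sum1_card (partition_big_imset (fun x => x *+ n)) /=.
rewrite -[X in (_ <= X)%N]sum_nat_const.
apply: leq_sum => _ /imsetP[x _ ->]; rewrite -(card_mulrn_fiber x) sum1dep_card.
by apply: subset_leq_card; apply/fintype.subsetP => y; rewrite !inE => /andP[].
Qed.

End Torsion.

(** * Character sums and subgroups *)

(** Translation by an [h] in [H] with [chi h != 1] multiplies the sum by [chi h], so the sum
    vanishes. *)
Lemma sum_character (F : idomainType) (M : finZmodType) (H : {set M}) (chi : M -> F) :
  zmod_closed H -> {morph chi : x y / x + y >-> x * y} ->
  \sum_(x in H) chi x = if [forall x in H, chi x == 1] then #|H|%:R else 0.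
Proof.
move=> [H0 HB] chiD; have HD : {in H &, forall x y, x + y \in H}.
  by move=> x y Hx Hy; rewrite -[y]opprK HB // -[- y]add0r HB.
case: ifP => [/forall_inP chi1|/negbT].
  by rewrite -sum1_card natr_sum; apply: eq_bigr => x /chi1/eqP.
case/forall_inPn => h Hh chi_h; apply/eqP.
have : (chi h - 1) * \sum_(x in H) chi x == 0.
  rewrite mulrBl mul1r subr_eq0 mulr_sumr [X in _ == X](reindex_inj (addrI h)) /=.
  apply/eqP/eq_big => [x|x _]; last by rewrite chiD.
  apply/idP/idP => [Hx|Hhx]; first exact: HD.
  by rewrite -[x](addKr h) addrC HB.
by rewrite mulf_eq0 subr_eq0 (negPf chi_h).
Qed.

(** Translation by [x] permutes [M], so the sum of all elements equals itself plus [x *+ #|M|]. *)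
Lemma mulrn_card (M : finZmodType) (x : M) : x *+ #|M| = 0.
Proof.
have : \sum_(y : M) y = \sum_y (x + y) by rewrite [LHS](reindex_inj (addrI x)).
rewrite big_split /= sumr_const => /eqP.
by rewrite -subr_eq subrr eq_sym => /eqP.
Qed.

Section Zmod.

Variables (M : finZmodType) (H : {set M}).
Hypothesis zH : zmod_closed H.

Lemma zmod_closed_opp x : x \in H -> - x \in H.
Proof. by have [H0 HB] := zH => Hx; rewrite -[- x]add0r HB. Qed.

Lemma zmod_closed_add x y : x \in H -> y \in H -> x + y \in H.
Proof. by move=> Hx Hy; rewrite -[y]opprK zH.2 // zmod_closed_opp. Qed.

Lemma zmod_closed_muln x n : x \in H -> x *+ n \in H.
Proof.
by move=> Hx; elim: n => [|n IHn]; [exact: zH.1 | rewrite mulrS zmod_closed_add].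
Qed.

Definition adjoin (w : M) : {set M} := [set x | `[< exists a : int, x - w *~ a \in H >]].

Lemma adjoinP w x : reflect (exists a : int, x - w *~ a \in H) (x \in adjoin w).
Proof. by rewrite inE; apply: asboolP. Qed.

Lemma adjoin_zmod w : zmod_closed (adjoin w).
Proof.
split=> [|x y /adjoinP[a Hx] /adjoinP[a' Hy]]; apply/adjoinP.
  by exists 0; rewrite mulr0z subr0 zH.1.
by exists (a - a'); rewrite mulrzBr opprD addrACA -opprD zH.2.
Qed.

Lemma sub_adjoin w : H \subset adjoin w.
Proof. by apply/fintype.subsetP => x Hx; apply/adjoinP; exists 0; rewrite mulr0z subr0. Qed.

Lemma mem_adjoin w : w \in adjoin w.
Proof. by apply/adjoinP; exists 1; rewrite mulr1z subrr zH.1. Qed.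

End Zmod.

(** * Quadratic characters and orthogonal complements *)

(* Written multiplicatively: q x stands for e(Q x), so polar x y is e(B(x, y)). *)
Section QuadraticCharacter.

Variables (F : numFieldType) (M : finZmodType) (q : M -> F).
Definition polar x y := q (x + y) / (q x * q y).
Local Notation b := polar.

Hypothesis q_neq0 : forall x, q x != 0.
Hypothesis qMz : forall x (a : int), q (x *~ a) = q x ^ (a ^+ 2).
Hypothesis polarDl : forall x y z, b (x + y) z = b x z * b y z.
Hypothesis polar_nondeg : forall x, (forall y, b x y = 1) -> x = 0.

Implicit Types (x y z h w : M) (H L : {set M}).

Lemma qMn x (n : nat) : q (x *+ n) = q x ^+ (n ^ 2).
Proof. by have := qMz x n; rewrite expr2 -PoszM mulnn. Qed.

Lemma q0 : q 0 = 1.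
Proof. by rewrite -(mulr0n 0) qMn. Qed.

Lemma qD x y : q (x + y) = q x * q y * b x y.
Proof. by rewrite /b mulrC divfK // mulf_neq0. Qed.

Lemma polarC x y : b x y = b y x.
Proof. by rewrite /b addrC (mulrC (q x)). Qed.

Lemma polarDr x y z : b z (x + y) = b z x * b z y.
Proof. by rewrite -!(polarC _ z) polarDl. Qed.

Lemma polar0l y : b 0 y = 1.
Proof. by rewrite /b add0r q0 mul1r divff. Qed.

Lemma polar_neq0 x y : b x y != 0.
Proof. by rewrite mulf_neq0 ?invr_eq0 ?mulf_neq0. Qed.

Lemma polarNl x y : b (- x) y = (b x y)^-1.
Proof. by apply: (mulfI (polar_neq0 x y)); rewrite -polarDl subrr polar0l divff ?polar_neq0. Qed.

Lemma polarMn x y (n : nat) : b (x *+ n) y = b x y ^+ n.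
Proof. by elim: n => [|n IHn]; rewrite ?polar0l // mulrSr polarDl IHn exprSr. Qed.

Lemma polarMz x y (a : int) : b (x *~ a) y = b x y ^ a.
Proof. by case: a => n; rewrite ?NegzE ?mulrNz ?polarNl -?pmulrn polarMn. Qed.

Lemma polarxx x : q x = 1 -> b x x = 1.
Proof. by move=> qx; rewrite /b -mulr2n qMn qx expr1n mulr1 divr1. Qed.

Definition perp H := [set x | [forall h in H, b x h == 1]].

Lemma perpP H x : reflect {in H, forall h, b x h = 1} (x \in perp H).
Proof. by rewrite inE; apply: (iffP forall_inP) => xH h /xH /eqP. Qed.

Lemma perp_zmod H : zmod_closed (perp H).
Proof.
split=> [|x y /perpP xH /perpP yH]; apply/perpP => h Hh; first exact: polar0l.
by rewrite polarDl polarNl xH // yH // invr1 mulr1.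
Qed.

Lemma perpN H x : (- x \in perp H) = (x \in perp H).
Proof.
have zP := perp_zmod H; apply/idP/idP => xH; last exact: zmod_closed_opp.
by rewrite -[x]opprK zmod_closed_opp.
Qed.

Lemma sum_polar H x : zmod_closed H ->
  \sum_(h in H) b x h = if x \in perp H then #|H|%:R else 0.
Proof. by move=> zH; rewrite (sum_character zH) ?inE // => y z; exact: polarDr. Qed.

(** Double count of the sum of [b x h] over [x] in [M] and [h] in [H]: by nondegeneracy only [h = 0]
    survives the sum over [x], and only [x \in perp H] survives the sum over [h]. *)
Lemma card_perp H : zmod_closed H -> (#|H| * #|perp H|)%N = #|M|.
Proof.
move=> zH; apply/eqP; rewrite -(eqr_nat F).
have outer h : \sum_x b x h = if h == 0 then #|M|%:R else 0.
  have zT : zmod_closed [set: M] by split=> [|x y]; rewrite !inE.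
  transitivity (\sum_(x in [set: M]) b x h); first by apply: eq_bigl => x; rewrite inE.
  rewrite (sum_character zT) ?cardsT => [|x y]; last exact: polarDl.
  have -> // : [forall x in [set: M], b x h == 1] = (h == 0).
  apply/forall_inP/eqP => [b1|-> x _]; last by rewrite polarC polar0l.
  by apply: polar_nondeg => y; rewrite polarC; apply/eqP/b1; rewrite inE.
have : \sum_(h in H) \sum_x b x h = \sum_x \sum_(h in H) b x h by rewrite exchange_big.
under eq_bigr do rewrite outer.
under [in RHS]eq_bigr do rewrite sum_polar //.
have [H0 _] := zH; rewrite (bigD1 0) //= eqxx big1 => [|h /andP[_ /negPf->]] //.
by rewrite addr0 -big_mkcond /= sumr_const natrM mulr_natr => ->.
Qed.

(** * Isotropic subgroups and the Gauss sum *)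

Definition isotropic H := zmod_closed H /\ {in H, forall x, q x = 1}.

Lemma isotropic_perp H : isotropic H -> H \subset perp H.
Proof.
move=> [[H0 HB] qH]; apply/fintype.subsetP => x Hx; apply/perpP => y Hy.
have Hxy : x + y \in H by rewrite -[y]opprK HB // -[- y]add0r HB.
by rewrite /b !qH // mulr1 divr1.
Qed.

(** Averaging over the translates [x + h] with [h] in [H] multiplies the term of [x] by a character
    sum over [H], which vanishes unless [x \in perp H]. *)
Lemma sum_isotropic H : isotropic H ->
  \sum_x (q x)^-1 = \sum_(x in perp H) (q x)^-1.
Proof.
move=> [zH qH]; have [H0 _] := zH.
have H_neq0 : #|H|%:R != 0 :> F by rewrite pnatr_eq0 -lt0n; apply/card_gt0P; exists 0.
apply: (mulfI H_neq0).
transitivity (\sum_(h in H) \sum_x (q (x + h))^-1).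
  rewrite mulr_natl -sumr_const; apply: eq_bigr => h _.
  by rewrite (reindex_inj (addIr h)).
rewrite exchange_big mulr_sumr [RHS]big_mkcond /=; apply: eq_bigr => x _.
transitivity ((q x)^-1 * \sum_(h in H) b (- x) h).
  rewrite mulr_sumr; apply: eq_bigr => h Hh.
  by rewrite qD (qH h Hh) mulr1 invfM polarNl.
by rewrite sum_polar // perpN mulrC; case: ifP; rewrite ?mul0r.
Qed.

Lemma isotropic_adjoin H w :
  isotropic H -> w \in perp H -> q w = 1 -> isotropic (adjoin H w).
Proof.
move=> [zH qH] /perpP wH qw; split=> [|x /adjoinP[a Hx]]; first exact: adjoin_zmod.
rewrite -[x](subrK (w *~ a)) qD qH // qMz qw exp1rz !mul1r.
by rewrite polarC polarMz wH // exp1rz.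
Qed.

Lemma perp_adjoin H w x : zmod_closed H ->
  (x \in perp (adjoin H w)) = (x \in perp H) && (b x w == 1).
Proof.
move=> zH; apply/perpP/andP => [xHw|[/perpP xH /eqP xw] h /adjoinP[a Hh]].
  by split; [apply/perpP => h /(fintype.subsetP (sub_adjoin H w))/xHw | rewrite xHw ?mem_adjoin].
by rewrite -[h](subrK (w *~ a)) polarDr xH // polarC polarMz polarC xw exp1rz mul1r.
Qed.

Lemma isotropic_set0 : isotropic [set 0].
Proof.
split=> [|x /set1P->]; last exact: q0.
by split=> [|x y /set1P-> /set1P->]; rewrite inE ?subrr.
Qed.

Lemma selfdual_of_leq H : isotropic H -> (#|perp H| <= #|H|)%N -> perp H = H.
Proof. by move=> isoH leH; apply/eqP; rewrite eq_sym eqEcard isotropic_perp. Qed.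

Lemma selfdual_of_gauss_sum (p r n : nat) (zeta : F) :
  prime p -> (p ^ r.+1).-primitive_root zeta ->
  (forall x, q x ^+ (p ^ r.+1) = 1) ->
  #|M| = (n ^ 2)%N -> \sum_x (q x)^-1 = n%:R ->
  exists2 L, isotropic L & perp L = L.
Proof.
move=> p_pr prim_zeta q_root cardM gaussM.
have [H maxH] : {H | maxset (fun H => `[< isotropic H >]) H}.
  by apply: ex_maxset; exists [set 0]; apply/asboolP/isotropic_set0.
have isoH : isotropic H by have /asboolP := maxsetp maxH.
have [zH qH] := isoH.
exists H => //; apply: selfdual_of_leq => //.
(* An isotropic [x] in [perp H] can be adjoined to [H], so by maximality it is already there. *)
have isoE : #|[pred x in perp H | (q x)^-1 == 1]| = #|H|.
  apply: eq_card => x; rewrite inE /= invr_eq1; apply/andP/idP => [[xH /eqP qx]|Hx].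
    rewrite -(maxsetsup maxH _ (sub_adjoin H x)) ?mem_adjoin //.
    by apply/asboolP/isotropic_adjoin.
  by rewrite (fintype.subsetP (isotropic_perp isoH)) // qH.
have qV_root x : (q x)^-1 ^+ (p ^ r.+1) = 1 by rewrite exprVn q_root invr1.
have gaussH : \sum_(x in perp H) (q x)^-1 = n%:R by rewrite -sum_isotropic.
have := root_sum_nat p_pr prim_zeta qV_root gaussH; rewrite isoE.
set B := #|_|; have leB : (#|H| <= B)%N.
  rewrite -isoE; apply/subset_leq_card/fintype.subsetP => x.
  by rewrite !inE => /andP[-> /eqP->]; rewrite expr1n /=.
move=> sumE; have p_gt1 := prime_gt1 p_pr.
(* From [n * p.-1 + B = p * #|H|] and [#|H| <= B] one gets [n * p.-1 <= #|H| * p.-1]. *)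
have len : (n <= #|H|)%N.
  rewrite -(@leq_pmul2r p.-1); last by case: (p) p_gt1 => [|[]].
  rewrite -(leq_add2r B) sumE -{1}(prednK (prime_gt0 p_pr)) mulSn [(#|H| * _)%N]mulnC addnC.
  by rewrite leq_add2l.
have H_gt0 : (0 < #|H|)%N by apply/card_gt0P; exists 0; apply: zH.1.
by rewrite -(leq_pmul2l H_gt0) card_perp // cardM -mulnn leq_mul.
Qed.

(** * Hyperbolic planes in rank two *)

Section RankTwo.

Variables (p k : nat) (H : {set M}) (y z : M) (c : nat).
Hypothesis p_pr : prime p.
Hypothesis cardM : #|M| = (p ^ k)%N.
Hypothesis rankM : (#|[set x : M | x *+ p == 0%R]| <= p ^ 2)%N.
Hypothesis isoH : isotropic H.
Hypothesis zH : z \in perp H.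
Hypothesis yH : y \in perp H.
Hypothesis qz : q z = 1.
Hypothesis zpH : z *+ p ^ c.+1 \in H.
Hypothesis ypH : y *+ p ^ c.+1 \in H.
Hypothesis yz_neq1 : b y (z *+ p ^ c) != 1.

(** The order of [b y z] divides [p ^ c.+1], because [z *+ p ^ c.+1] lies in [H] and [y] in
    [perp H], but it does not divide [p ^ c]. *)
Lemma polar_primitive : (p ^ c.+1).-primitive_root (b y z).
Proof.
have u1 : b y z ^+ (p ^ c.+1) = 1.
  by rewrite polarC -polarMn polarC; move/perpP: yH; apply.
have pc_gt0 : (0 < p ^ c.+1)%N by rewrite expn_gt0 prime_gt0.
have [m prim_m] := prim_order_exists pc_gt0 u1.
case/(dvdn_pfactor _ _ p_pr) => e le_ec mE; rewrite mE in prim_m.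
move: le_ec; rewrite leq_eqVlt => /predU1P[<- //|]; rewrite ltnS => le_ec.
case/negP: yz_neq1; rewrite polarC polarMn polarC -(prim_order_dvd prim_m).
exact: dvdn_exp2l.
Qed.

Lemma perp_pair_torsion x :
  x \in perp H -> b x y = 1 -> b x z = 1 -> x *+ p \in H -> x \in H.
Proof.
have [zmH qH] := isoH; have p_gt0 := prime_gt0 p_pr.
move=> xH xy xz xp.
pose D0 := [set x in perp H | [&& b x y == 1, b x z == 1 & x *+ p \in H]].
pose D := [set x in perp H | x *+ p \in H].
(* H is contained in D0, and pairing with z and y shows that f embeds p ^ 2
   copies of D0 in D; but #|D| <= p ^ 2 #|H| by the rank bound, so D0 = H. *)
pose f (t : M * ('I_p * 'I_p)) := t.1 + (z *+ p ^ c *+ t.2.1 + y *+ p ^ c *+ t.2.2).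
have prim_p : p.-primitive_root (b y z ^+ (p ^ c)).
  have := dvdn_prim_root polar_primitive (dvdn_exp (ltn0Sn c) (dvdnn p)).
  by rewrite expnSr mulnK.
have f_inj : {in finset.setX D0 finset.setT &, injective f}.
  move=> [d [i j]] [d' [i' j']]; rewrite !finset.in_setX.
  move=> /andP[/setIdP[_ /and3P[/eqP dy /eqP dz _]] _].
  move=> /andP[/setIdP[_ /and3P[/eqP d'y /eqP d'z _]] _]; rewrite /f /= => eq_f.
  (* Pairing with [z] reads off [j], as [b z z = 1]; once the multiples of [y] agree, the powers of
     [b y y] cancel and pairing with [y] reads off [i]. *)
  have jj : j = j'.
    have := congr1 (fun t => b t z) eq_f; rewrite /= !polarDl !polarMn dz d'z (polarxx qz).
    rewrite !expr1n !mul1r => /eqP; rewrite (eq_prim_root_expr prim_p) !modn_small //.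
    by move=> /eqP jj; apply: val_inj.
  have ii : i = i'.
    have := congr1 (fun t => b t y) eq_f; rewrite /= !polarDl jj dy d'y !mul1r.
    move/(mulIf (polar_neq0 _ _)); rewrite !polarMn [b z y]polarC => /eqP.
    by rewrite (eq_prim_root_expr prim_p) !modn_small // => /eqP ii; apply: val_inj.
  by move: eq_f; rewrite ii jj => /addIr ->.
have f_D : f @: finset.setX D0 finset.setT \subset D.
  apply/fintype.subsetP => _ /imsetP[[d [i j]] /finset.setXP[/setIdP[dH /and3P[_ _ dp]] _] ->].
  have zmP := perp_zmod H; apply/setIdP; split.
    by rewrite zmod_closed_add // zmod_closed_add // !zmod_closed_muln.
  rewrite /f /= !mulrnDl zmod_closed_add // zmod_closed_add //.
    by rewrite mulrnAC -(mulrnA z) -expnSr zmod_closed_muln.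
  by rewrite mulrnAC -(mulrnA y) -expnSr zmod_closed_muln.
have le_D : (#|D| <= #|H| * p ^ 2)%N.
  apply: leq_trans (card_mulrn_leq p D) _; apply: leq_mul => //.
  by apply/subset_leq_card/fintype.subsetP => _ /imsetP[t /setIdP[_ tp] ->].
have le_D0 : (#|D0| <= #|H|)%N.
  rewrite -(@leq_pmul2r (p ^ 2)) ?expn_gt0 ?p_gt0 //.
  apply: leq_trans le_D; rewrite -mulnn.
  have := subset_leq_card f_D; rewrite card_in_imset // cardsX cardsT card_prod.
  by rewrite !card_ord.
have H_D0 : H \subset D0.
  apply/fintype.subsetP => h Hh; rewrite inE (fintype.subsetP (isotropic_perp isoH)) //=.
  move/perpP: yH => /(_ h Hh); move/perpP: zH => /(_ h Hh).
  by rewrite ![b _ h]polarC => -> ->; rewrite !eqxx zmod_closed_muln.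
have -> : H = D0 by apply/eqP; rewrite eqEcard H_D0.
by rewrite inE xH xy xz !eqxx.
Qed.

(** Modulo [H], the elements of [perp H] orthogonal to [y] and [z] form a [p]-group without
    [p]-torsion, hence a trivial one. *)
Lemma perp_pair x : x \in perp H -> b x y = 1 -> b x z = 1 -> x \in H.
Proof.
have [zmH qH] := isoH.
suff descend j : forall x, x \in perp H -> b x y = 1 -> b x z = 1 ->
    x *+ p ^ j \in H -> x \in H.
  by move=> xH xy xz; apply: (descend k) => //; rewrite -cardM mulrn_card zmH.1.
elim: j => [|j IHj] t tH ty tz; first by rewrite mulr1n.
rewrite expnS mulrnA => /IHj tp; apply: perp_pair_torsion => //; apply: tp.
- exact: zmod_closed_muln (perp_zmod H) _ _ tH.
- by rewrite polarMn ty expr1n.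
- by rewrite polarMn tz expr1n.
Qed.

(** If [x] is orthogonal to [H] and [z], some multiple of [z] has the same pairing with [y] as [x],
    since [b y z] is primitive; the difference is then orthogonal to both [y] and [z], so it lies in
    [H]. *)
Lemma selfdual_pair : isotropic (adjoin H z) /\ perp (adjoin H z) = adjoin H z.
Proof.
have [zmH _] := isoH; have isoL : isotropic (adjoin H z) by exact: isotropic_adjoin.
split=> //; apply/eqP; rewrite finset.eqEsubset isotropic_perp // andbT.
apply/fintype.subsetP => x; rewrite perp_adjoin // => /andP[xH /eqP xz].
have xy1 : b x y ^+ (p ^ c.+1) = 1.
  by rewrite polarC -polarMn polarC; move/perpP: xH; apply.
have [i xyE] := prim_rootP polar_primitive xy1.
apply/adjoinP; exists (i : nat); rewrite -pmulrn.
have zmP := perp_zmod H.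
apply: perp_pair.
- by apply: zmP.2 => //; apply: zmod_closed_muln.
- by rewrite polarDl polarNl polarMn xyE [b z y]polarC divff ?expf_neq0 ?polar_neq0.
- by rewrite polarDl polarNl polarMn xz polarxx // expr1n invr1 mulr1.
Qed.

End RankTwo.

(** The last two hypotheses are what invariance under [T] and [S] says about [v], with [a] in place
    of the scalar of [weilS]. *)
Lemma selfdual_of_invariant (p k : nat) (a : F) (v : M -> F) :
  prime p -> #|M| = (p ^ k)%N -> (#|[set x : M | x *+ p == 0%R]| <= p ^ 2)%N ->
  (exists x, v x != 0) -> (forall x, v x != 0 -> q x = 1) ->
  (forall y, v y = a * \sum_x (b y x)^-1 * v x) ->
  exists2 L, isotropic L & perp L = L.
Proof.
move=> p_pr cardM rankM [x0 vx0] v_iso vS.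
pose P H := `[< isotropic H /\ forall x, v x != 0 -> x \in perp H >].
have [H maxH] : {H | maxset P H}.
  apply: ex_maxset; exists [set 0]; apply/asboolP; split; first exact: isotropic_set0.
  by move=> x _; apply/perpP => _ /set1P->; rewrite polarC polar0l.
have /asboolP[isoH vH] := maxsetp maxH.
have [zmH qH] := isoH.
have [/forallP vsub|/forallPn[x1]] := boolP [forall x, (v x != 0) ==> (x \in H)].
  exists H => //; apply: selfdual_of_leq => //.
  (* The translate of [perp H] by [x0] is contained in [H]: for [g] in [perp H] the formula [vS]
     gives [v (x0 + g) = v x0], which is nonzero. *)
  rewrite -(card_imset (mem (perp H)) (addrI x0)).
  apply/subset_leq_card/fintype.subsetP => _ /imsetP[g gH ->].
  apply: (implyP (vsub _)); suff -> : v (x0 + g) = v x0 by [].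
  rewrite !vS; congr (_ * _); apply: eq_bigr => x _.
  have [->|vx] := eqVneq (v x) 0; first by rewrite !mulr0.
  rewrite polarDl; move/perpP: gH => -> //; last exact: (implyP (vsub x)).
  by rewrite mulr1.
rewrite negb_imply => /andP[vx1 x1H].
(* The largest [c] with [A c] makes [p ^ c.+1] the exponent of the support modulo [H]. *)
pose A c := [exists x, (v x != 0) && (x *+ p ^ c \notin H)].
have exA : exists c, A c by exists 0%N; apply/existsP; exists x1; rewrite vx1 expn0 mulr1n.
have boundA c : A c -> (c <= k)%N.
  move=> /existsP[x /andP[_]]; apply: contraR; rewrite -ltnNge => /ltnW lt_kc.
  by rewrite -(subnKC lt_kc) expnD mulrnA -cardM mulrn_card mul0rn zmH.1.
case: (ex_maxnP exA boundA) => c /existsP[z /andP[vz zcH]] max_c.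
have in_H x : v x != 0 -> x *+ p ^ c.+1 \in H.
  move=> vx; apply: contraT => xH; have : A c.+1 by apply/existsP; exists x; rewrite vx.
  by move/max_c; rewrite ltnn.
pose w := z *+ p ^ c.
have wH : w \in perp H by apply: zmod_closed_muln (perp_zmod H) _ _ (vH z vz).
have qw : q w = 1 by rewrite qMn v_iso // expr1n.
(* Otherwise [adjoin H w] would satisfy [P], and maximality would put [w] in [H]. *)
have [y vy yw] : exists2 y, v y != 0 & b y w != 1.
  have [/forallP vw|/forallPn[y]] := boolP [forall y, (v y != 0) ==> (b y w == 1)].
    case/negP: zcH; rewrite -(maxsetsup maxH _ (sub_adjoin H w)) ?mem_adjoin //.
    apply/asboolP; split; first exact: isotropic_adjoin.
    by move=> x vx; rewrite perp_adjoin // vH // (implyP (vw x)).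
  by rewrite negb_imply => /andP[vy yw]; exists y.
have [] // := selfdual_pair p_pr cardM rankM isoH (vH z vz) (vH y vy) (v_iso z vz)
  (in_H z vz) (in_H y vy) yw.
by exists (adjoin H z).
Qed.

End QuadraticCharacter.

(** Kernel and cokernel of multiplication by [p] on a finite group have the same order. *)
Lemma card_torsion_leq (p k : nat) (M : finZmodType) :
  prime p -> #|M| = (p ^ k)%N -> (dim_mod_p M p <= 2)%N ->
  (#|[set x : M | x *+ p == 0%R]| <= p ^ 2)%N.
Proof.
move=> p_pr cardM; have cardE := card_mulrn M p.
have im_gt0 : (0 < #|pmult_set M p|)%N.
  by apply/card_gt0P; exists 0; apply/imsetP; exists 0; rewrite ?mul0rn.
rewrite /dim_mod_p cardE mulKn //.
have : (#|[set x : M | (x *+ p == 0)%R]| %| p ^ k)%N by rewrite -cardM cardE dvdn_mull.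
by case/(dvdn_pfactor _ _ p_pr) => e _ ->; rewrite pfactorK // leq_exp2l ?prime_gt1.
Qed.

(** * Back to [Q] and the Weil representation *)

Section QuadraticModule.

Variables (R : realType) (M : finZmodType) (Q : M -> rat).
Hypothesis fqmQ : is_fqm Q.
Hypothesis nondegQ : fqm_nondegenerate Q.
Let q (x : M) := e_ R (Q x).

Lemma e_eq_mod (s t : rat) : s - t \is a Num.int -> e_ R s = e_ R t.
Proof. by rewrite -(e_eq1 R) => /eqP st1; rewrite -[s](subrK t) e_D st1 mul1r. Qed.

Lemma e_Q_neq0 x : q x != 0.
Proof. exact: e_neq0. Qed.

Lemma e_QMz x (a : int) : q (x *~ a) = q x ^ (a ^+ 2).
Proof. by rewrite /q (e_eq_mod (fqmQ.1 x a)) -rmorphXn e_intM. Qed.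

Lemma e_bil x y : e_ R (bil Q x y) = polar q x y.
Proof. by rewrite /bil !e_D !e_N -mulrA -invfM. Qed.

Lemma e_bilDl x y z : polar q (x + y) z = polar q x z * polar q y z.
Proof.
rewrite -!e_bil -e_D; apply: e_eq_mod; rewrite opprD addrA; exact: fqmQ.2.1.
Qed.

Lemma e_bil_nondeg x : (forall y, polar q x y = 1) -> x = 0.
Proof. by move=> xM; apply: nondegQ => y; rewrite /is_intq -(e_eq1 R) e_bil xM. Qed.

(** Already [q x ^+ (#|M| ^ 2) = q (x *+ #|M|) = 1]; the extra factor [n] gives the exponent the
    successor form used for the Gauss sum. *)
Lemma e_Q_root (n k : nat) x : #|M| = (n ^ k)%N -> q x ^+ (n ^ (k * 2).+1) = 1.
Proof.
move=> cardM; rewrite expnSr expnM -cardM exprM -(qMn e_QMz) mulrn_card.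
by rewrite (q0 e_QMz) expr1n.
Qed.

Lemma sigmaE (n : nat) : #|M| = (n ^ 2)%N ->
  sigma_fqm R Q = n%:R^-1 * \sum_x (q x)^-1.
Proof.
move=> cardM; rewrite /sigma_fqm cardM natrX sqrtr_sqr ger0_norm ?ler0n //.
by rewrite fmorphV rmorph_nat; congr (_ * _); apply: eq_bigr => x _; rewrite e_N.
Qed.

(** The Fourier transform of the indicator of [L] is [#|L|] times that of [perp q L = L], and
    [#|L| = n] cancels the normalisation. *)
Lemma invariant_of_selfdual L (n : nat) : #|M| = (n ^ 2)%N -> sigma_fqm R Q = 1 ->
  isotropic q L -> perp q L = L -> Inv_nonzero R Q.
Proof.
move=> cardM sigma1 [zL qL] perpL; have [L0 _] := zL.
have cardL : #|L| = n.
  have := card_perp e_Q_neq0 e_QMz e_bilDl e_bil_nondeg zL.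
  by rewrite perpL cardM mulnn => /eqP; rewrite eqn_exp2r // => /eqP.
have n_neq0 : n%:R != 0 :> R[i].
  by rewrite pnatr_eq0 -lt0n -cardL; apply/card_gt0P; exists 0.
exists [ffun x => (x \in L)%:R]; split; last split.
- by apply/eqP => /ffunP/(_ 0); rewrite !ffunE L0 => /eqP; rewrite oner_eq0.
- apply/ffunP => x; rewrite !ffunE; have [/qL qx|_] := boolP (x \in L).
    by rewrite mulr1.
  by rewrite mulr0.
- apply/ffunP => y; rewrite !ffunE sigma1 mul1r cardM natrX sqrtr_sqr ger0_norm ?ler0n //.
  rewrite fmorphV rmorph_nat.
  transitivity (n%:R^-1 * \sum_(x in L) polar q (- y) x).
    congr (_ * _); rewrite [RHS]big_mkcond /=; apply: eq_bigr => x _.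
    rewrite ffunE e_N e_bil (polarNl e_Q_neq0 e_QMz e_bilDl).
    by case: (x \in L); rewrite ?mulr1 ?mulr0.
  rewrite (sum_polar e_bilDl) // (perpN e_Q_neq0 e_QMz e_bilDl) perpL cardL.
  by case: (y \in L); rewrite ?mulVf ?mulr0.
Qed.

End QuadraticModule.

Theorem theorem2 (R : realType) (p : nat) (M : finZmodType) (Q : M -> rat) :
  prime p ->
  is_fqm Q -> fqm_nondegenerate Q ->
  (exists k : nat, #|M| = (p ^ k)%N) ->
  (dim_mod_p M p <= 2)%N ->
  (Inv_nonzero R Q <->
   ((exists n : nat, #|M| = (n ^ 2)%N) /\ sigma_fqm R Q = 1)).
Proof.
move=> p_pr fqmQ nondegQ [k cardM] dim_le2.
have q_neq0 := @e_Q_neq0 R M Q; have qMz := e_QMz R fqmQ.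
have bDl := e_bilDl R fqmQ; have nondeg := e_bil_nondeg nondegQ (R := R).
split=> [[v [v_neq0 [vT vS]]]|[[n cardMn] sigma1]].
  have [L isoL perpL] : exists2 L, isotropic (fun x => e_ R (Q x)) L
      & perp (fun x => e_ R (Q x)) L = L.
    apply: (selfdual_of_invariant q_neq0 qMz bDl (v := v) p_pr cardM).
    - exact: card_torsion_leq p_pr cardM dim_le2.
    - apply: contrapT => v0; case/eqP: v_neq0.
      apply/ffunP => x; rewrite ffunE; apply/eqP/negPn/negP => vx.
      by apply: v0; exists x.
    - move=> x vx; have := congr1 (fun w : {ffun M -> R[i]} => w x) vT.
      by rewrite ffunE -[X in _ = X]mul1r => /(mulIf vx).
    - move=> y; rewrite -{1}vS ffunE; congr (_ * _); apply: eq_bigr => x _.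
      by rewrite e_N e_bil.
  have [zL qL] := isoL.
  have cardL : #|M| = (#|L| ^ 2)%N.
    by rewrite -(card_perp q_neq0 qMz bDl nondeg zL) perpL mulnn.
  split; first by exists #|L|.
  have [L0 _] := zL.
  have L_neq0 : #|L|%:R != 0 :> R[i] by rewrite pnatr_eq0 -lt0n; apply/card_gt0P; exists 0.
  (* The Gauss sum reduces to [perp L = L], where every term is 1. *)
  rewrite (sigmaE _ _ cardL) (sum_isotropic q_neq0 qMz bDl isoL) perpL.
  under eq_bigr do [rewrite qL // invr1].
  by rewrite sumr_const mulVf.
have n_neq0 : n%:R != 0 :> R[i].
  rewrite pnatr_eq0 -lt0n -(@ltn_exp2r _ _ 2) // -cardMn.
  by apply/card_gt0P; exists 0.
have gauss : \sum_x (e_ R (Q x))^-1 = n%:R.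
  by move: sigma1; rewrite (sigmaE _ _ cardMn) => /(canRL (mulVKf n_neq0)); rewrite mulr1.
have N_gt0 : (0 < p ^ (k * 2).+1)%N by rewrite expn_gt0 prime_gt0.
have [L isoL perpL] := selfdual_of_gauss_sum q_neq0 qMz bDl nondeg p_pr
  (e_primitive_root R N_gt0) (fun x => e_Q_root R fqmQ x cardM) cardMn gauss.
exact: (invariant_of_selfdual fqmQ nondegQ cardMn sigma1 isoL perpL).
Qed.
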